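(* Let $\delta,\rho,H>0$ satisfy $1<\frac{\rho}{\delta+H}\leq e$, put $\kappa=\ln\left(\frac{\rho}{\delta+H}\right)$, and let $\sigma_0>0$ be the unique number satisfying $H\sigma_0e^{1+\delta\sigma_0}=1$. Suppose that $$0\leq\sigma\leq\sigma_0,\qquad 0\leq r<r_*,$$ where $r_*$ is defined in the context. Consider the delay differential system $$\begin{cases}u_1'(t)=-\delta u_1(t)+\rho u_1(t-r)e^{-u_1(t-r)}-Hu_2(t-\sigma),\\ u_2'(t)=-\delta u_2(t)+\rho u_1(t-r)e^{-u_1(t-r)}-Hu_2(t-\sigma),\end{cases}$$ with equilibria $E_1=(0,0)$ and $E_2=(\kappa,\kappa)$. Then all characteristic roots associated with $E_2$ have negative real parts, whereas $E_1$ is hyperbolic and its unstable manifold is one-dimensional.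
   Context: The characteristic roots associated with an equilibrium are the roots $z\in\mathbb C$ of the characteristic equation of the linearization of the system at that equilibrium. At $E_1$ the characteristic equation is $(z+\delta)\chi_1(z)=0$ and at $E_2$ it is $(z+\delta)\chi_2(z)=0$, where $$\chi_1(z)=z+\delta+He^{-\sigma z}-\rho e^{-rz},\qquad \chi_2(z)=z+\delta+He^{-\sigma z}-(\delta+H)(1-\kappa)e^{-rz}.$$ An equilibrium is hyperbolic if it has no characteristic root on the imaginary axis; the dimension of its unstable manifold is the number of characteristic roots, counted with multiplicity, with positive real part. Definition of $r_*$. Set $$\omega_-=\sqrt{(\rho-H)^2-\delta^2},\qquad \omega_+=\sqrt{(\rho+H)^2-\delta^2}$$ (since $\rho>\delta+H$, $\omega_->0$). For $\omega\in[\omega_-,\omega_+]$ set $$R(\omega)=\sqrt{\delta^2+\omega^2},\qquad \alpha(\omega)=\arctan\left(\frac{\omega}{\delta}\right),\qquad \beta_\rho(\omega)=\arccos\left(\frac{\rho^2-H^2+R(\omega)^2}{2\rho R(\omega)}\right).$$ Then $$r_*=\min_{\omega\in[\omega_-,\omega_+]}\frac{2\pi-\alpha(\omega)-\beta_\rho(\omega)}{\omega}.$$ *)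

(* Defs.v *)
From Stdlib Require Import Reals Lra List.
From Coquelicot Require Import Coquelicot.
Open Scope R_scope.

Definition vec := (R * R)%type.

Inductive idx := i1 | i2.

Definition coord (i : idx) (p : vec) : R :=
  match i with i1 => fst p | i2 => snd p end.

Definition set_coord (j : idx) (s : R) (p : vec) : vec :=
  match j with i1 => (s, snd p) | i2 => (fst p, s) end.

Definition jacobian (G : vec -> vec) (p : vec) (i j : idx) : R :=
  Derive (fun s => coord i (G (set_coord j s p))) (coord j p).

(* A map F : vec -> vec -> vec -> vec stands for the delay equation
   u'(t) = F (u t) (u (t - r)) (u (t - sigma)). *)
Definition is_equilibrium (F : vec -> vec -> vec -> vec) (E : vec) : Prop :=
  F E E E = (0, 0).

Definition Cexp (z : C) : C :=
  (exp (Re z) * cos (Im z), exp (Re z) * sin (Im z)).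

Definition Cdet2 (M : idx -> idx -> C) : C :=
  (M i1 i1 * M i2 i2 - M i1 i2 * M i2 i1)%C.

(* The linearization at E is v'(t) = A v(t) + B v(t - r) + D v(t - sigma),
   where A, B, D are the Jacobians of F with respect to its first, second and
   third argument; its characteristic function is
   det (z I - A - e^(-r z) B - e^(-sigma z) D). *)
Definition char_matrix (F : vec -> vec -> vec -> vec) (r sigma : R) (E : vec)
    (z : C) (i j : idx) : C :=
  let A := jacobian (fun x => F x E E) E in
  let B := jacobian (fun y => F E y E) E in
  let D := jacobian (fun w => F E E w) E in
  ((match i, j with i1, i1 => z | i2, i2 => z | _, _ => RtoC 0 end)
   - RtoC (A i j)
   - RtoC (B i j) * Cexp (- (RtoC r * z))
   - RtoC (D i j) * Cexp (- (RtoC sigma * z)))%C.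

Definition char_fun (F : vec -> vec -> vec -> vec) (r sigma : R) (E : vec)
    (z : C) : C :=
  Cdet2 (char_matrix F r sigma E z).

Definition is_char_root (F : vec -> vec -> vec -> vec) (r sigma : R) (E : vec)
    (z : C) : Prop :=
  char_fun F r sigma E z = RtoC 0.

Definition hyperbolic (F : vec -> vec -> vec -> vec) (r sigma : R) (E : vec)
    : Prop :=
  forall z : C, is_char_root F r sigma E z -> Re z <> 0.

(* For entire f (every [char_fun] is entire, so the total [C_derive] is its
   complex derivative), z is a zero of order
   exactly m; the order is 0 when f z <> 0. *)
Definition has_order (f : C -> C) (z : C) (m : nat) : Prop :=
  (forall k : nat, (k < m)%nat -> Nat.iter k C_derive f z = RtoC 0) /\
  Nat.iter m C_derive f z <> RtoC 0.

(* The zeros of f satisfying P are finite in number, and n is their number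
   counted with multiplicity; l lists them without repetition, each paired
   with its multiplicity. *)
Definition zero_count (f : C -> C) (P : C -> Prop) (n : nat) : Prop :=
  exists l : list (C * nat),
    NoDup (map fst l) /\
    (forall z : C, In z (map fst l) <-> f z = RtoC 0 /\ P z) /\
    (forall (z : C) (m : nat), In (z, m) l -> has_order f z m) /\
    n = list_sum (map snd l).

Definition unstable_dim (F : vec -> vec -> vec -> vec) (r sigma : R) (E : vec)
    (n : nat) : Prop :=
  zero_count (char_fun F r sigma E) (fun z => 0 < Re z) n.

Definition rhs (delta rho H : R) (x y w : vec) : vec :=
  (- delta * fst x + rho * fst y * exp (- fst y) - H * snd w,
   - delta * snd x + rho * fst y * exp (- fst y) - H * snd w).

Definition kappa (delta rho H : R) : R := ln (rho / (delta + H)).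

Definition omega_minus (delta rho H : R) : R :=
  sqrt ((rho - H) ^ 2 - delta ^ 2).

Definition omega_plus (delta rho H : R) : R :=
  sqrt ((rho + H) ^ 2 - delta ^ 2).

Definition Rmod (delta omega : R) : R := sqrt (delta ^ 2 + omega ^ 2).

Definition alpha (delta omega : R) : R := atan (omega / delta).

Definition beta (delta rho H omega : R) : R :=
  acos ((rho ^ 2 - H ^ 2 + Rmod delta omega ^ 2)
        / (2 * rho * Rmod delta omega)).

Definition delay_curve (delta rho H omega : R) : R :=
  (2 * PI - alpha delta omega - beta delta rho H omega) / omega.

(* A greatest lower bound; [r_star_min] shows that it is an attained minimum. *)
Definition r_star (delta rho H : R) : R :=
  real (Glb_Rbar (fun y => exists omega : R,
    omega_minus delta rho H <= omega <= omega_plus delta rho H /\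
    y = delay_curve delta rho H omega)).

Lemma delay_curve_continuous (delta rho H omega : R) :
  0 < delta -> 0 < H -> H < rho -> 0 < omega ->
  continuity_pt (delay_curve delta rho H) omega.
Proof.
intros Hd HH Hr Hw.
assert (HR : forall w, 0 < Rmod delta w).
{ intro w. apply sqrt_lt_R0. nra. }
pose (X := fun w => (rho ^ 2 - H ^ 2 + Rmod delta w ^ 2) / (2 * rho * Rmod delta w)).
assert (HX : forall w, 0 < X w).
{ intro w. specialize (HR w). apply Rdiv_lt_0_compat; nra. }
apply continuity_pt_ext with
  (fun w => (2 * PI - atan (w / delta) - atan (sqrt (1 - (X w)²) / X w)) / w).
{ intro w. unfold delay_curve, alpha, beta. fold (X w). now rewrite acos_atan. }
assert (CR : continuity_pt (Rmod delta) omega).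
{ apply continuity_pt_filterlim.
  apply (continuous_comp (fun w => delta ^ 2 + w ^ 2) sqrt).
  - apply (ex_derive_continuous (V := R_NormedModule)); auto_derive; auto.
  - apply continuous_sqrt. }
assert (CX : continuity_pt X omega).
{ apply continuity_pt_div.
  - apply continuity_pt_plus.
    + apply continuity_pt_const; now intros ? ?.
    + apply (continuity_pt_comp (Rmod delta) (fun t => t ^ 2)); auto.
      apply derivable_continuous_pt, derivable_pt_pow.
  - apply continuity_pt_mult; auto. apply continuity_pt_const; now intros ? ?.
  - specialize (HR omega). nra. }
assert (CI : continuity_pt (fun w : R => w) omega)
  by apply derivable_continuous_pt, derivable_pt_id.
apply continuity_pt_div; auto; try lra.
apply continuity_pt_minus.
- apply continuity_pt_minus.
  + apply continuity_pt_const; now intros ? ?.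
  + apply (continuity_pt_comp (fun w => w / delta) atan).
    * apply continuity_pt_div; auto; try lra.
      apply continuity_pt_const; now intros ? ?.
    * apply derivable_continuous_pt, derivable_pt_atan.
- apply (continuity_pt_comp (fun w => sqrt (1 - (X w)²) / X w) atan).
  + apply continuity_pt_div; auto.
    * apply (continuity_pt_comp (fun w => 1 - (X w)²) sqrt).
      -- apply continuity_pt_minus; [apply continuity_pt_const; now intros ? ?|].
         now apply continuity_pt_mult.
      -- apply continuity_pt_filterlim, continuous_sqrt.
    * specialize (HX omega). lra.
  + apply derivable_continuous_pt, derivable_pt_atan.
Qed.

Lemma r_star_min (delta rho H : R) :
  0 < delta -> 0 < H -> delta + H < rho ->
  (exists omega : R,
    omega_minus delta rho H <= omega <= omega_plus delta rho H /\
    r_star delta rho H = delay_curve delta rho H omega) /\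
  (forall omega : R,
    omega_minus delta rho H <= omega <= omega_plus delta rho H ->
    r_star delta rho H <= delay_curve delta rho H omega).
Proof.
intros Hd HH Hr.
assert (Hm : 0 < omega_minus delta rho H) by (apply sqrt_lt_R0; nra).
assert (Hmp : omega_minus delta rho H <= omega_plus delta rho H)
  by (apply sqrt_le_1_alt; nra).
destruct (continuity_ab_min (delay_curve delta rho H) _ _ Hmp)
  as [w [Hmin Hw]].
{ intros c Hc. apply delay_curve_continuous; lra. }
assert (E : r_star delta rho H = delay_curve delta rho H w).
{ unfold r_star.
  rewrite (is_glb_Rbar_unique _ (Finite (delay_curve delta rho H w))); auto.
  split.
  - intros y [o [Ho ->]]. now apply Hmin.
  - intros b Hb. apply Hb. now exists w. }
split; [now exists w|]. intros o Ho. rewrite E. now apply Hmin.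
Qed.

(* Main.v *)
Require Import Defs.
From Stdlib Require Import Reals Lra Lia List.
From Coquelicot Require Import Coquelicot.
Open Scope R_scope.

(** Write p(z) = z + d + H e^(-s z), with d for delta and s for sigma. At an
    equilibrium (k, k) the characteristic function factors as
    (z + d) (p(z) - c e^(-r z)) with c = rho (1 - k) e^(-k)
    ([char_fun_rhs]), so only the zeros of chi(z) = p(z) - c e^(-r z) with
    Re z >= 0 matter. The bound on sigma says that H s e^(1 + d s) <= 1, and
    since e^(1 + t) > 2 + t it makes h = s H e^(-s x), the modulus of
    p'(z) - 1 at z = x + i y, satisfy h (2 + s (d + x)) < 1 and h < 4/9 in
    the closed right half-plane ([short_delay_shift]). Everything about p
    follows from these two inequalities.

    At E2, c = (d + H) (1 - kappa) lies in [0, d + H), whereas |p| >= d + H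
    on the closed right half-plane ([p_modulus_ge]); so p dominates
    c e^(-r z) there and chi has no zero, whatever r is.

    At E1, c = rho > d + H. On the half-line [0, +oo) chi is real, strictly
    increasing and negative at 0, which gives one simple positive zero. What
    remains is that there is no zero z = x + i y with x >= 0 and y > 0; those
    with y < 0 follow by conjugation. Suppose that there is one. Since
    Im p > 0, the argument of p is taken in (0, PI), and the equation says
    that |p(z)| e^(r x) = rho and that the phase r y + arg p(z), being a
    positive multiple of 2 PI, is at least 2 PI ([chi_zero_phase]); in
    particular r y > PI. Instead of following the zero as r varies, the bad
    phase is carried to the imaginary axis at fixed r along a broken line.
    Moving left from x + i y to i y, arg p increases ([p_arg_le_axis]) and
    |p| e^(r x) decreases ([p_modulus_le_axis]), so |p(i y)| <= rho. Moving
    up from i y, the phase increases ([phase_increasing]) until a point i w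
    with |p(i w)| = rho is met ([modulus_level_on_axis]). There
    r w + arg p(i w) >= 2 PI, while the triangle with vertices 0, d + i w and
    p(i w) has sides R(w), H and rho, so that w lies in
    [omega_minus, omega_plus] ([axis_level_range]) and
    arg p(i w) <= alpha(w) + beta(w) ([p_arg_axis_le]). Hence
    r >= (2 PI - alpha(w) - beta(w)) / w >= r_star, a contradiction. *)

(** * Elementary real inequalities *)

Lemma sqr_sin_le_sqr (t : R) : sin t ^ 2 <= t ^ 2.
Proof.
assert (P : forall u, 0 < u -> sin u ^ 2 <= u ^ 2).
{ intros u Hu. pose proof (sin_lt_x u Hu). pose proof (SIN_bound u).
  destruct (Rle_lt_dec 0 (sin u)); [nra|].
  destruct (Rle_lt_dec 1 u); [nra|].
  pose proof PI2_3_2. pose proof (sin_gt_0 u Hu). lra. }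
destruct (Rtotal_order t 0) as [Ht|[->|Ht]].
- specialize (P (- t)). rewrite sin_neg in P. nra.
- rewrite sin_0. lra.
- auto.
Qed.

Lemma cos_half_angle (t : R) : cos t = 1 - 2 * sin (t / 2) ^ 2.
Proof.
replace t with (2 * (t / 2)) at 1 by lra. rewrite cos_2a_sin. ring.
Qed.

Lemma cos_ge_quadratic (t : R) : 1 - t ^ 2 / 2 <= cos t.
Proof.
rewrite cos_half_angle. pose proof (sqr_sin_le_sqr (t / 2)). nra.
Qed.

Lemma cos_ge_linear (t : R) : 0 <= t -> 1 - t <= cos t.
Proof.
intros Ht. rewrite cos_half_angle.
pose proof (sqr_sin_le_sqr (t / 2)). pose proof (SIN_bound (t / 2)).
assert (sin (t / 2) ^ 2 <= 1) by nra.
destruct (Rle_lt_dec t 2); nra.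
Qed.

Lemma sin_le_id (t : R) : 0 <= t -> sin t <= t.
Proof.
intros [Ht| <-]; [left; now apply sin_lt_x|rewrite sin_0; lra].
Qed.

Lemma mul_sin_le (s y : R) : 0 <= s -> y * sin (s * y) <= s * y ^ 2.
Proof.
intros Hs. destruct (Rle_lt_dec 0 y) as [Hy|Hy].
- assert (0 <= s * y) by nra. pose proof (sin_le_id (s * y) H). nra.
- assert (0 <= s * - y) by nra. pose proof (sin_le_id (s * - y) H).
  replace (s * - y) with (- (s * y)) in H0 by ring.
  rewrite sin_neg in H0. nra.
Qed.

Lemma exp_le_exp (x y : R) : x <= y -> exp x <= exp y.
Proof. intros [Hxy| ->]; [left; now apply exp_increasing|lra]. Qed.

Lemma le_of_derive_nonneg (f df : R -> R) (a b : R) :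
  a <= b ->
  (forall x, a <= x <= b -> is_derive f x (df x)) ->
  (forall x, a <= x <= b -> 0 <= df x) ->
  f a <= f b.
Proof.
intros Hab Hf Hdf.
destruct (MVT_gen f a b df) as [c [Hc E]].
- rewrite Rmin_left, Rmax_right by lra. intros x Hx. apply Hf. lra.
- rewrite Rmin_left, Rmax_right by lra. intros x Hx.
  apply continuity_pt_filterlim, (ex_derive_continuous (V := R_NormedModule)).
  eexists; now apply Hf.
- rewrite Rmin_left, Rmax_right in Hc by lra.
  specialize (Hdf c Hc). nra.
Qed.

(** * The argument of a point of the upper half-plane *)

(** Written with atan of the cotangent so that it is one smooth formula on the
    whole open upper half-plane. *)
Definition upper_arg (a b : R) : R := PI / 2 - atan (a / b).

Lemma upper_arg_bound (a b : R) : 0 < upper_arg a b < PI.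
Proof. unfold upper_arg. pose proof (atan_bound (a / b)). lra. Qed.

Lemma sqrt_1_slope (m a b : R) :
  0 < b -> 0 < m -> a ^ 2 + b ^ 2 = m ^ 2 -> sqrt (1 + (a / b)²) = m / b.
Proof.
intros Hb Hm E. rewrite <- (sqrt_pow2 (m / b)).
- f_equal. replace ((m / b) ^ 2) with (m ^ 2 / b ^ 2) by (field; lra).
  rewrite <- E. unfold Rsqr. field. lra.
- apply Rlt_le, Rdiv_lt_0_compat; lra.
Qed.

Lemma upper_arg_polar (m a b : R) :
  0 < b -> 0 < m -> a ^ 2 + b ^ 2 = m ^ 2 ->
  a = m * cos (upper_arg a b) /\ b = m * sin (upper_arg a b).
Proof.
intros Hb Hm E. unfold upper_arg.
rewrite cos_shift, sin_shift, sin_atan, cos_atan.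
rewrite (sqrt_1_slope m) by auto. split; field; lra.
Qed.

(** * The function p in the closed right half-plane *)

(** Real and imaginary parts of p(z) = z + d + H e^(-s z) at z = x + i y. *)
Definition p_re (d H s x y : R) : R := d + x + H * exp (- (s * x)) * cos (s * y).
Definition p_im (d H s x y : R) : R := y - H * exp (- (s * x)) * sin (s * y).

(** Equality in the last condition is the case in which p has a double real
    zero, at - (d + 1 / s). *)
Definition short_delay (d H s : R) : Prop :=
  0 < d /\ 0 < H /\ 0 <= s /\ H * s * exp (1 + d * s) <= 1.

(** Shifting by x turns d into d + x and H into H e^(-s x) and leaves
    H s e^(1 + d s) unchanged, so the smallness condition persists along the
    right half-plane. Both numerical bounds come from lower bounds on
    e^(1 + t), t = s (d + x): e^(1 + t) > 2 + t and
    e^(1 + t) >= (e^(1/2))^2 > (3/2)^2 = 9/4. *)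
Lemma short_delay_shift (d H s x : R) :
  short_delay d H s -> 0 <= x ->
  0 < H * exp (- (s * x)) /\
  0 <= s * (H * exp (- (s * x))) < 4 / 9 /\
  s * (H * exp (- (s * x))) * (2 + s * (d + x)) < 1.
Proof.
intros (Hd & HH & Hs & Hb) Hx.
pose proof (exp_pos (- (s * x))) as Hp.
set (h := s * (H * exp (- (s * x)))).
assert (Hh : 0 <= h) by (unfold h; apply Rmult_le_pos; nra).
assert (E : h * exp (1 + s * (d + x)) <= 1).
{ replace (1 + s * (d + x)) with (s * x + (1 + d * s)) by ring.
  rewrite exp_plus. unfold h.
  replace (s * (H * exp (- (s * x))) * (exp (s * x) * exp (1 + d * s)))
    with (H * s * exp (1 + d * s) * (exp (- (s * x)) * exp (s * x))) by ring.
  rewrite <- exp_plus. replace (- (s * x) + s * x) with 0 by ring.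
  rewrite exp_0. lra. }
assert (Ht : 0 <= s * (d + x)) by nra.
assert (E1 : 1 + (1 + s * (d + x)) < exp (1 + s * (d + x)))
  by (apply exp_ineq1; lra).
assert (E2 : 9 / 4 < exp (1 + s * (d + x))).
{ replace (1 + s * (d + x)) with (1 / 2 + (1 / 2 + s * (d + x))) by field.
  rewrite exp_plus.
  pose proof (exp_ineq1 (1 / 2)). pose proof (exp_ineq1 (1 / 2 + s * (d + x))).
  nra. }
repeat split; try nra.
Qed.

(** With D = d + x, K = H e^(-s x) and t = s y,
    |p|^2 = (D + K)^2 + y^2 - 2 D K (1 - cos t) - 2 K y sin t, and the
    estimates 1 - cos t <= t^2 / 2 and y sin t <= s y^2 leave
    |p|^2 >= (D + K)^2 + y^2 (1 - s K (2 + s D)). *)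
Lemma p_modulus_ge (d H s x y : R) :
  short_delay d H s -> 0 <= x ->
  (d + H) ^ 2 <= p_re d H s x y ^ 2 + p_im d H s x y ^ 2.
Proof.
intros Hsd Hx. destruct (short_delay_shift _ _ _ _ Hsd Hx) as (HK & Hh & Hh2).
pose proof (short_delay_shift _ _ _ _ Hsd (Rle_refl 0)) as (_ & Hh0 & _).
destruct Hsd as (Hd & HH & Hs & _).
(* x + H e^(-s x) does not decrease below its value H at 0 because s H < 1 *)
assert (HDK : d + H <= d + x + H * exp (- (s * x))).
{ pose proof (exp_ineq1_le (- (s * x))).
  rewrite Rmult_0_r, Ropp_0, exp_0 in Hh0. nra. }
unfold p_re, p_im.
set (K := H * exp (- (s * x))) in *. set (D := d + x) in *.
assert (HD : 0 < D) by (unfold D; lra).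
pose proof (cos_ge_quadratic (s * y)) as Hc.
pose proof (mul_sin_le s y Hs) as Hsin.
pose proof (sin2_cos2 (s * y)) as Hsc. unfold Rsqr in Hsc.
apply Rle_trans with ((D + K) ^ 2); [apply pow_incr; lra|].
assert (0 <= D * K * (cos (s * y) - (1 - (s * y) ^ 2 / 2))) by (apply Rmult_le_pos; nra).
assert (0 <= K * (s * y ^ 2 - y * sin (s * y))) by nra.
assert (0 <= y ^ 2 * (1 - s * K * (2 + s * D))) by (apply Rmult_le_pos; nra).
assert (K ^ 2 * (sin (s * y) * sin (s * y) + cos (s * y) * cos (s * y)) = K ^ 2)
  by (rewrite Hsc; ring).
nra.
Qed.

(** On the open first quadrant this keeps p in the upper half-plane, where its
    argument is continuous; the constant is 1 - 4/9. *)
Lemma p_im_ge (d H s x y : R) :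
  short_delay d H s -> 0 <= x -> 0 < y -> 5 / 9 * y <= p_im d H s x y.
Proof.
intros Hsd Hx Hy. destruct (short_delay_shift _ _ _ _ Hsd Hx) as (HK & Hh & _).
destruct Hsd as (_ & _ & Hs & _). unfold p_im.
set (K := H * exp (- (s * x))) in *.
assert (0 <= s * y) by nra.
pose proof (sin_le_id (s * y)). nra.
Qed.

(** The expression is |p|^2 times the real part of r + p'/p, the logarithmic
    derivative of e^(r z) p(z): it governs both the growth of |p| e^(r x) in
    x and that of the phase r y + arg p in y. The real part of p'/p may be
    negative, but Re (p' conj p) >= - 2 h y >= - (8/9) y, while
    |p| >= Im p >= (5/9) y and r y >= PI > 3 give r |p|^2 >= (75/81) y, which
    is larger. *)
Lemma radial_growth (d H s r x y : R) :
  short_delay d H s -> 0 <= x -> 0 < y -> PI <= r * y ->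
  0 <= r * (p_re d H s x y ^ 2 + p_im d H s x y ^ 2)
       + (p_re d H s x y * (1 - s * (H * exp (- (s * x))) * cos (s * y))
          + p_im d H s x y * (s * (H * exp (- (s * x))) * sin (s * y))).
Proof.
intros Hsd Hx Hy Hry.
pose proof (p_im_ge _ _ _ _ _ Hsd Hx Hy) as HI.
destruct (short_delay_shift _ _ _ _ Hsd Hx) as (HK & Hh & _).
destruct Hsd as (Hd & _ & Hs & _).
set (X := p_re d H s x y ^ 2 + p_im d H s x y ^ 2).
assert (HX : 25 / 81 * y ^ 2 <= X) by (unfold X; nra).
assert (HrX : 75 / 81 * y <= r * X).
{ pose proof PI2_3_2. apply Rmult_le_reg_l with y; auto.
  assert (3 * X <= r * y * X) by (apply Rmult_le_compat_r; nra). nra. }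
unfold p_re, p_im.
set (K := H * exp (- (s * x))) in *. set (D := d + x) in *.
assert (HD : 0 < D) by (unfold D; lra).
assert (Hsy : 0 <= s * y) by nra.
pose proof (cos_ge_linear (s * y) Hsy) as Hc.
pose proof (SIN_bound (s * y)). pose proof (COS_bound (s * y)).
pose proof (sin2_cos2 (s * y)) as Hsc. unfold Rsqr in Hsc.
assert (0 <= D * (1 - s * K * cos (s * y))) by (apply Rmult_le_pos; nra).
assert (0 <= K * (cos (s * y) - (1 - s * y))) by nra.
assert (0 <= s * K * y * (1 + sin (s * y))) by (apply Rmult_le_pos; nra).
assert (0 <= K * (1 - s * K)) by nra.
assert (0 <= y * (4 / 9 - s * K)) by nra.
assert (s * K * K * (sin (s * y) * sin (s * y) + cos (s * y) * cos (s * y)) = s * K * K)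
  by (rewrite Hsc; ring).
nra.
Qed.

(** The expression is - Im (p' conj p), that is |p|^2 times minus the derivative
    of arg p in x. With D = d + x, K = H e^(-s x) and t = s y it equals
    y - K sin t - y s K cos t - s D K sin t, hence is at least
    y (1 - s K (2 + s D)). *)
Lemma angular_decay (d H s x y : R) :
  short_delay d H s -> 0 <= x -> 0 < y ->
  0 <= (1 - s * (H * exp (- (s * x))) * cos (s * y)) * p_im d H s x y
       - p_re d H s x y * (s * (H * exp (- (s * x))) * sin (s * y)).
Proof.
intros Hsd Hx Hy.
destruct (short_delay_shift _ _ _ _ Hsd Hx) as (HK & Hh & Hh2).
destruct Hsd as (Hd & _ & Hs & _).
unfold p_re, p_im.
set (K := H * exp (- (s * x))) in *. set (D := d + x) in *.
assert (HD : 0 < D) by (unfold D; lra).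
assert (Hsy : 0 <= s * y) by nra.
pose proof (sin_le_id (s * y) Hsy).
pose proof (COS_bound (s * y)).
assert (0 <= K * (1 + s * D) * (s * y - sin (s * y))) by (apply Rmult_le_pos; nra).
assert (0 <= y * (s * K) * (1 - cos (s * y))) by (apply Rmult_le_pos; nra).
assert (0 <= y * (1 - s * K * (2 + s * D))) by nra.
nra.
Qed.

Definition p_arg (d H s x y : R) : R := upper_arg (p_re d H s x y) (p_im d H s x y).

Lemma p_arg_le_axis (d H s x y : R) :
  short_delay d H s -> 0 <= x -> 0 < y -> p_arg d H s x y <= p_arg d H s 0 y.
Proof.
intros Hsd Hx Hy.
enough (- p_arg d H s 0 y <= - p_arg d H s x y) by lra.
apply (le_of_derive_nonneg (fun t => - p_arg d H s t y)
  (fun t => ((1 - s * (H * exp (- (s * t))) * cos (s * y)) * p_im d H s t y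
       - p_re d H s t y * (s * (H * exp (- (s * t))) * sin (s * y)))
    / (p_re d H s t y ^ 2 + p_im d H s t y ^ 2)) 0 x Hx).
- intros t [Ht _].
  pose proof (p_im_ge _ _ _ _ _ Hsd Ht Hy) as HI.
  assert (HN : 0 < p_re d H s t y ^ 2 + p_im d H s t y ^ 2) by nra.
  unfold p_arg, upper_arg. unfold p_re, p_im in *.
  auto_derive; [lra|]. field. split; lra.
- intros t [Ht _].
  pose proof (p_im_ge _ _ _ _ _ Hsd Ht Hy) as HI.
  apply Rdiv_le_0_compat; [now apply angular_decay|nra].
Qed.

Lemma phase_increasing (d H s r y w : R) :
  short_delay d H s -> 0 < y <= w -> PI <= r * y ->
  r * y + p_arg d H s 0 y <= r * w + p_arg d H s 0 w.
Proof.
intros Hsd [Hy Hyw] Hry.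
assert (Hr : 0 <= r) by (pose proof PI_RGT_0; nra).
apply (le_of_derive_nonneg (fun t => r * t + p_arg d H s 0 t)
  (fun t => (r * (p_re d H s 0 t ^ 2 + p_im d H s 0 t ^ 2)
       + (p_re d H s 0 t * (1 - s * (H * exp (- (s * 0))) * cos (s * t))
          + p_im d H s 0 t * (s * (H * exp (- (s * 0))) * sin (s * t))))
     / (p_re d H s 0 t ^ 2 + p_im d H s 0 t ^ 2)) y w Hyw);
intros t Ht;
assert (Ht0 : 0 < t) by lra;
pose proof (p_im_ge _ _ _ _ _ Hsd (Rle_refl 0) Ht0) as HI;
assert (HN : 0 < p_re d H s 0 t ^ 2 + p_im d H s 0 t ^ 2) by nra.
- unfold p_arg, upper_arg. unfold p_re, p_im in *.
  auto_derive; [lra|]. field. split; lra.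
- apply Rdiv_le_0_compat; [|nra]. apply radial_growth; auto; nra.
Qed.

Lemma p_modulus_le_axis (d H s r x y : R) :
  short_delay d H s -> 0 <= x -> 0 < y -> PI <= r * y ->
  p_re d H s 0 y ^ 2 + p_im d H s 0 y ^ 2
  <= (p_re d H s x y ^ 2 + p_im d H s x y ^ 2) * exp (2 * r * x).
Proof.
intros Hsd Hx Hy Hry.
replace (p_re d H s 0 y ^ 2 + p_im d H s 0 y ^ 2) with
  ((p_re d H s 0 y ^ 2 + p_im d H s 0 y ^ 2) * exp (2 * r * 0))
  by (rewrite Rmult_0_r, exp_0; ring).
apply (le_of_derive_nonneg
  (fun t => (p_re d H s t y ^ 2 + p_im d H s t y ^ 2) * exp (2 * r * t))
  (fun t => 2 * exp (2 * r * t) *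
     (r * (p_re d H s t y ^ 2 + p_im d H s t y ^ 2)
       + (p_re d H s t y * (1 - s * (H * exp (- (s * t))) * cos (s * y))
          + p_im d H s t y * (s * (H * exp (- (s * t))) * sin (s * y))))) 0 x Hx).
- intros t _. unfold p_re, p_im. auto_derive; [auto|]. ring.
- intros t [Ht _]. pose proof (exp_pos (2 * r * t)).
  apply Rmult_le_pos; [lra|now apply radial_growth].
Qed.

Lemma modulus_level_on_axis (d H s rho y : R) :
  0 < H -> 0 < rho -> 0 < y ->
  p_re d H s 0 y ^ 2 + p_im d H s 0 y ^ 2 <= rho ^ 2 ->
  exists w, y <= w /\ p_re d H s 0 w ^ 2 + p_im d H s 0 w ^ 2 = rho ^ 2.
Proof.
intros HH Hrho Hy Hle.
set (f := fun w => p_re d H s 0 w ^ 2 + p_im d H s 0 w ^ 2).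
assert (Hf : continuity f).
{ intros w. apply continuity_pt_filterlim.
  apply (ex_derive_continuous (V := R_NormedModule)).
  unfold f, p_re, p_im. auto_derive; auto. }
assert (HW : rho ^ 2 <= f (y + rho + H)).
{ unfold f, p_im. rewrite Rmult_0_r, Ropp_0, exp_0.
  pose proof (SIN_bound (s * (y + rho + H))).
  pose proof (pow2_ge_0 (p_re d H s 0 (y + rho + H))).
  assert (rho <= y + rho + H - H * 1 * sin (s * (y + rho + H))) by nra.
  nra. }
destruct (IVT_gen f y (y + rho + H) (rho ^ 2) Hf) as [w [Hw E]].
- fold (f y) in Hle. rewrite Rmin_left, Rmax_right by lra. lra.
- rewrite Rmin_left, Rmax_right in Hw by lra. exists w. split; [lra|exact E].
Qed.

(** * The triangle with sides rho, R(w) and H *)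

(** (R(w), alpha(w)) are the polar coordinates of d + i w. *)
Lemma atan_polar (d w : R) :
  0 < d -> 0 < Rmod d w /\
  d = Rmod d w * cos (alpha d w) /\ w = Rmod d w * sin (alpha d w).
Proof.
intros Hd.
assert (HR : 0 < Rmod d w) by (apply sqrt_lt_R0; nra).
split; auto. unfold alpha. rewrite sin_atan, cos_atan.
assert (HR2 : Rmod d w * Rmod d w = d ^ 2 + w ^ 2) by (apply sqrt_sqrt; nra).
rewrite (sqrt_1_slope (Rmod d w)); auto; [|nra]. split; field; lra.
Qed.

(** In the triangle with vertices 0, d + i w and p(i w) the angle at 0 is
    |arg p(i w) - alpha(w)|, and beta(w) is the same angle computed by the law
    of cosines. *)
Lemma p_arg_axis_le (d H s rho w : R) :
  short_delay d H s -> H < rho -> 0 < w ->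
  p_re d H s 0 w ^ 2 + p_im d H s 0 w ^ 2 = rho ^ 2 ->
  p_arg d H s 0 w <= alpha d w + beta d rho H w.
Proof.
intros Hsd Hrho Hw E.
pose proof (p_im_ge _ _ _ _ _ Hsd (Rle_refl 0) Hw) as HI.
destruct Hsd as (Hd & HH & Hs & _).
destruct (atan_polar d w Hd) as (HR & Ed & Ew).
assert (HR2 : Rmod d w * Rmod d w = d ^ 2 + w ^ 2) by (apply sqrt_sqrt; nra).
destruct (upper_arg_polar rho (p_re d H s 0 w) (p_im d H s 0 w))
  as [Ea Eb]; try lra.
fold (p_arg d H s 0 w) in Ea, Eb.
assert (Harg : 0 < p_arg d H s 0 w < PI) by apply upper_arg_bound.
assert (Hal : 0 < alpha d w).
{ unfold alpha. rewrite <- atan_0. apply atan_increasing.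
  apply Rdiv_lt_0_compat; lra. }
set (a := p_arg d H s 0 w) in *.
assert (Ecos : (rho ^ 2 - H ^ 2 + Rmod d w ^ 2) / (2 * rho * Rmod d w)
               = cos (a - alpha d w)).
{ apply Rmult_eq_reg_r with (2 * rho * Rmod d w); [|nra].
  replace ((rho ^ 2 - H ^ 2 + Rmod d w ^ 2) / (2 * rho * Rmod d w)
    * (2 * rho * Rmod d w)) with (rho ^ 2 - H ^ 2 + Rmod d w * Rmod d w)
    by (field; lra).
  rewrite cos_minus.
  replace ((cos a * cos (alpha d w) + sin a * sin (alpha d w))
     * (2 * rho * Rmod d w)) with
    (2 * ((rho * cos a) * (Rmod d w * cos (alpha d w))
       + (rho * sin a) * (Rmod d w * sin (alpha d w)))) by ring.
  rewrite <- Ea, <- Eb, <- Ed, <- Ew, HR2, <- E.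
  unfold p_re, p_im. rewrite Rmult_0_r, Ropp_0, exp_0.
  pose proof (sin2_cos2 (s * w)) as Hsc. unfold Rsqr in Hsc.
  assert (H ^ 2 * (sin (s * w) * sin (s * w) + cos (s * w) * cos (s * w)) = H ^ 2)
    by (rewrite Hsc; ring).
  nra. }
unfold beta. rewrite Ecos.
destruct (Rle_lt_dec a (alpha d w)) as [Hle|Hlt].
- pose proof (acos_bound (cos (a - alpha d w))). lra.
- rewrite acos_cos; lra.
Qed.

(** The triangle inequality |rho - H| <= R(w) <= rho + H, squared. *)
Lemma axis_level_range (d H s rho w : R) :
  0 < d -> 0 < H -> d + H < rho -> 0 < w ->
  p_re d H s 0 w ^ 2 + p_im d H s 0 w ^ 2 = rho ^ 2 ->
  omega_minus d rho H <= w <= omega_plus d rho H.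
Proof.
intros Hd HH Hrho Hw E.
assert (HR : 0 < Rmod d w) by (apply sqrt_lt_R0; nra).
assert (HR2 : Rmod d w * Rmod d w = d ^ 2 + w ^ 2) by (apply sqrt_sqrt; nra).
unfold p_re, p_im in E. rewrite Rmult_0_r, Ropp_0, exp_0 in E.
pose proof (sin2_cos2 (s * w)) as Hsc. unfold Rsqr in Hsc.
set (c := cos (s * w)) in *. set (n := sin (s * w)) in *.
set (R0 := Rmod d w) in *.
(* Cauchy-Schwarz, via Lagrange's identity *)
assert (HCS : (d * c - w * n) ^ 2 <= R0 ^ 2).
{ assert (0 <= (d * n + w * c) ^ 2) by apply pow2_ge_0.
  assert ((d * c - w * n) ^ 2 + (d * n + w * c) ^ 2
    = (d ^ 2 + w ^ 2) * (n * n + c * c)) by ring.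
  nra. }
assert (HT : rho ^ 2 = R0 ^ 2 + H ^ 2 + 2 * H * (d * c - w * n)).
{ assert (H ^ 2 * (n * n + c * c) = H ^ 2) by (rewrite Hsc; ring). nra. }
assert (Habs : - R0 <= d * c - w * n <= R0) by (split; nra).
assert (Hlo : rho - H <= R0) by nra.
assert (Hhi : R0 <= rho + H) by nra.
unfold omega_minus, omega_plus. rewrite <- (sqrt_pow2 w) by lra.
split; apply sqrt_le_1_alt; nra.
Qed.

(** * Zeros of the quasi-polynomial *)

Definition chi (d H s r c : R) (z : C) : C :=
  (z + RtoC d + RtoC H * Cexp (- (RtoC s * z)) - RtoC c * Cexp (- (RtoC r * z)))%C.

Lemma chi_components (d H s r c x y : R) :
  chi d H s r c (x, y) =
  (p_re d H s x y - c * exp (- (r * x)) * cos (r * y),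
   p_im d H s x y + c * exp (- (r * x)) * sin (r * y)).
Proof.
unfold chi, Cexp, RtoC, Cminus, Cplus, Copp, Cmult, p_re, p_im, Re, Im; simpl.
replace (- (s * x - 0 * y)) with (- (s * x)) by ring.
replace (- (s * y + 0 * x)) with (- (s * y)) by ring.
replace (- (r * x - 0 * y)) with (- (r * x)) by ring.
replace (- (r * y + 0 * x)) with (- (r * y)) by ring.
rewrite !cos_neg, !sin_neg. f_equal; ring.
Qed.

Lemma chi_zero (d H s r c x y : R) :
  chi d H s r c (x, y) = RtoC 0 <->
  p_re d H s x y = c * exp (- (r * x)) * cos (r * y) /\
  p_im d H s x y = - (c * exp (- (r * x)) * sin (r * y)).
Proof.
rewrite chi_components. unfold RtoC. split.
- intros E. injection E. lra.
- intros [E1 E2]. f_equal; lra.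
Qed.

Lemma chi_zero_modulus (d H s r c x y : R) :
  chi d H s r c (x, y) = RtoC 0 ->
  p_re d H s x y ^ 2 + p_im d H s x y ^ 2 = (c * exp (- (r * x))) ^ 2.
Proof.
intros E. apply chi_zero in E as [-> ->].
pose proof (sin2_cos2 (r * y)) as Hsc. unfold Rsqr in Hsc. set (m := c * exp (- (r * x))).
replace (m ^ 2) with (m ^ 2 * (sin (r * y) * sin (r * y) + cos (r * y) * cos (r * y)))
  by (rewrite Hsc; ring). ring.
Qed.

Lemma chi_zero_conj (d H s r c x y : R) :
  chi d H s r c (x, y) = RtoC 0 -> chi d H s r c (x, - y) = RtoC 0.
Proof.
rewrite !chi_zero. unfold p_re, p_im.
rewrite !Ropp_mult_distr_r_reverse, !cos_neg, !sin_neg. lra.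
Qed.

Lemma dominated_chi_stable (d H s r c : R) (z : C) :
  short_delay d H s -> 0 <= r -> 0 <= c < d + H ->
  chi d H s r c z = RtoC 0 -> Re z < 0.
Proof.
destruct z as [x y]. simpl. intros Hsd Hr Hc E.
destruct (Rlt_le_dec x 0) as [Hx|Hx]; auto. exfalso.
pose proof (p_modulus_ge d H s x y Hsd Hx) as Hge.
rewrite (chi_zero_modulus _ _ _ _ _ _ _ E) in Hge.
pose proof (exp_pos (- (r * x))).
assert (exp (- (r * x)) <= 1) by (rewrite <- exp_0; apply exp_le_exp; nra).
assert (0 <= c * exp (- (r * x)) <= c) by nra. nra.
Qed.

(** At a zero, p = rho e^(-r x) e^(-i r y), so e^(i (r y + arg p)) = 1; and
    r y + arg p > 0 because arg p > 0. *)
Lemma chi_zero_phase (d H s r rho x y : R) :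
  short_delay d H s -> 0 < rho -> 0 <= r -> 0 <= x -> 0 < y ->
  chi d H s r rho (x, y) = RtoC 0 ->
  2 * PI <= r * y + p_arg d H s x y.
Proof.
intros Hsd Hrho Hr Hx Hy E.
pose proof (p_im_ge _ _ _ _ _ Hsd Hx Hy) as HI.
pose proof (chi_zero_modulus _ _ _ _ _ _ _ E) as Hm.
apply chi_zero in E as [Ea Eb].
set (m := rho * exp (- (r * x))) in *.
assert (Hm0 : 0 < m) by (apply Rmult_lt_0_compat; [lra|apply exp_pos]).
destruct (upper_arg_polar m _ (p_im d H s x y) ltac:(lra) Hm0 Hm) as [Pa Pb].
fold (p_arg d H s x y) in Pa, Pb.
pose proof (upper_arg_bound (p_re d H s x y) (p_im d H s x y)) as Harg.
fold (p_arg d H s x y) in Harg.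
set (a := p_arg d H s x y) in *.
assert (C1 : cos (r * y + a) = 1).
{ rewrite cos_plus.
  assert (cos a = cos (r * y)) by (apply Rmult_eq_reg_l with m; lra).
  assert (sin a = - sin (r * y)) by (apply Rmult_eq_reg_l with m; lra).
  rewrite H0, H1. pose proof (sin2_cos2 (r * y)) as Hsc. unfold Rsqr in Hsc. lra. }
destruct (Rle_lt_dec (2 * PI) (r * y + a)) as [|Hlt]; auto. exfalso.
rewrite cos_half_angle in C1.
assert (0 < sin ((r * y + a) / 2)) by (apply sin_gt_0; nra).
nra.
Qed.

(** The transport of a non-real zero to the imaginary axis: left at constant
    height, then up the axis to the level |p| = rho. *)
Lemma chi_no_nonreal_zero (d H s r rho x y : R) :
  short_delay d H s -> d + H < rho -> 0 <= r < r_star d rho H ->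
  0 <= x -> chi d H s r rho (x, y) = RtoC 0 -> y = 0.
Proof.
intros Hsd Hrho Hr Hx.
assert (Hup : forall y, 0 < y -> chi d H s r rho (x, y) <> RtoC 0).
{ clear y. intros y Hy E.
  assert (Hd : 0 < d) by apply Hsd. assert (HH : 0 < H) by apply Hsd.
  assert (Hph : 2 * PI <= r * y + p_arg d H s x y)
    by (apply chi_zero_phase with rho; auto; lra).
  assert (Harg : p_arg d H s x y < PI) by apply upper_arg_bound.
  assert (Hry : PI <= r * y) by lra.
  pose proof (p_modulus_le_axis d H s r x y Hsd Hx Hy Hry) as Hmod.
  rewrite (chi_zero_modulus _ _ _ _ _ _ _ E) in Hmod.
  replace ((rho * exp (- (r * x))) ^ 2 * exp (2 * r * x)) with (rho ^ 2) in Hmod.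
  2:{ replace (2 * r * x) with (r * x + r * x) by ring.
      rewrite exp_plus, exp_Ropp. field. pose proof (exp_pos (r * x)). lra. }
  destruct (modulus_level_on_axis d H s rho y) as [w [Hyw Ew]]; try lra.
  pose proof (p_arg_le_axis d H s x y Hsd Hx Hy).
  pose proof (phase_increasing d H s r y w Hsd (conj Hy Hyw) Hry).
  assert (Hw : 0 < w) by lra.
  assert (p_arg d H s 0 w <= alpha d w + beta d rho H w)
    by (apply p_arg_axis_le with (s := s); auto; lra).
  assert (Hrange : omega_minus d rho H <= w <= omega_plus d rho H)
    by (apply axis_level_range with s; auto).
  pose proof (proj2 (r_star_min d rho H Hd HH Hrho) w Hrange) as Hmin.
  assert (Hlt : r < delay_curve d rho H w) by lra.
  unfold delay_curve in Hlt. apply Rmult_lt_compat_r with (r := w) in Hlt; auto.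
  unfold Rdiv in Hlt. rewrite Rmult_assoc, Rinv_l in Hlt by lra. lra. }
intros E. destruct (Rtotal_order y 0) as [Hy|[Hy|Hy]]; auto; exfalso.
- apply (Hup (- y)); [lra|]. now apply chi_zero_conj.
- now apply (Hup y).
Qed.

(** * The real zero *)

Definition chi_real (d H s r c x : R) : R :=
  x + d + H * exp (- (s * x)) - c * exp (- (r * x)).

Lemma chi_RtoC (d H s r c x : R) :
  chi d H s r c (RtoC x) = RtoC (chi_real d H s r c x).
Proof.
unfold RtoC at 1. rewrite chi_components. unfold p_re, p_im, chi_real, RtoC.
rewrite !Rmult_0_r, cos_0, sin_0. f_equal; ring.
Qed.

(** The derivative is positive on [0, +oo) because s H e^(-s x) < 1; this
    gives both uniqueness and simplicity of the positive zero. *)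
Lemma chi_real_derive (d H s r c x : R) :
  short_delay d H s -> 0 <= r -> 0 <= c -> 0 <= x ->
  exists l, 0 < l /\ is_derive (chi_real d H s r c) x l.
Proof.
intros Hsd Hr Hc Hx.
destruct (short_delay_shift _ _ _ _ Hsd Hx) as (_ & Hh & _).
exists (1 - s * (H * exp (- (s * x))) + c * (r * exp (- (r * x)))). split.
- pose proof (exp_pos (- (r * x))).
  assert (0 <= c * (r * exp (- (r * x)))) by (apply Rmult_le_pos; nra). lra.
- unfold chi_real. auto_derive; [auto|]. ring.
Qed.

Lemma chi_real_increasing (d H s r c x y : R) :
  short_delay d H s -> 0 <= r -> 0 <= c -> 0 <= x < y ->
  chi_real d H s r c x < chi_real d H s r c y.
Proof.
intros Hsd Hr Hc [Hx Hxy].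
apply (incr_function_le (chi_real d H s r c) 0 p_infty (Derive (chi_real d H s r c)));
simpl; auto.
- intros t Ht _. destruct (chi_real_derive d H s r c t) as [l [_ Hl]]; auto.
  apply Derive_correct. now exists l.
- intros t Ht _. destruct (chi_real_derive d H s r c t) as [l [Hl0 Hl]]; auto.
  rewrite (is_derive_unique _ _ _ Hl). lra.
Qed.

Lemma chi_real_positive_zero (d H s r c : R) :
  0 < H -> 0 <= r -> d + H < c -> 0 < d ->
  exists x, 0 < x /\ chi_real d H s r c x = 0.
Proof.
intros HH Hr Hc Hd.
assert (Hcont : continuity (chi_real d H s r c)).
{ intros w. apply continuity_pt_filterlim.
  apply (ex_derive_continuous (V := R_NormedModule)).
  unfold chi_real. auto_derive; auto. }
assert (H0 : chi_real d H s r c 0 < 0).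
{ unfold chi_real. rewrite !Rmult_0_r, Ropp_0, exp_0. lra. }
assert (H1 : 0 < chi_real d H s r c c).
{ unfold chi_real. pose proof (exp_pos (- (s * c))).
  assert (exp (- (r * c)) <= 1) by (rewrite <- exp_0; apply exp_le_exp; nra).
  nra. }
destruct (IVT _ 0 c Hcont ltac:(lra) H0 H1) as [x [Hx E]].
exists x. split; auto. destruct (Req_dec x 0) as [->|]; lra.
Qed.

(** * The characteristic function at a diagonal point *)

Lemma char_fun_rhs (d rho H r s k : R) (z : C) :
  char_fun (rhs d rho H) r s (k, k) z
  = ((z + RtoC d) * chi d H s r (rho * (1 - k) * exp (- k)) z)%C.
Proof.
assert (A : forall i j, jacobian (fun x => rhs d rho H x (k, k) (k, k)) (k, k) i j
  = match i, j with i1, i1 | i2, i2 => - d | _, _ => 0 end).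
{ intros [] []; unfold jacobian, rhs; simpl; apply is_derive_unique;
  auto_derive; auto; ring. }
assert (B : forall i j, jacobian (fun x => rhs d rho H (k, k) x (k, k)) (k, k) i j
  = match j with i1 => rho * (1 - k) * exp (- k) | i2 => 0 end).
{ intros [] []; unfold jacobian, rhs; simpl; apply is_derive_unique;
  auto_derive; auto; ring. }
assert (D : forall i j, jacobian (fun x => rhs d rho H (k, k) (k, k) x) (k, k) i j
  = match j with i1 => 0 | i2 => - H end).
{ intros [] []; unfold jacobian, rhs; simpl; apply is_derive_unique;
  auto_derive; auto; ring. }
unfold char_fun, Cdet2, char_matrix, chi. rewrite !A, !B, !D.
rewrite !RtoC_opp. ring.
Qed.

Lemma char_root_rhs (d rho H r s k : R) (z : C) :
  is_char_root (rhs d rho H) r s (k, k) z <->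
  z = (- RtoC d)%C \/ chi d H s r (rho * (1 - k) * exp (- k)) z = RtoC 0.
Proof.
unfold is_char_root. rewrite char_fun_rhs. split.
- intros E. destruct (Ceq_dec (z + RtoC d) 0) as [E1|E1]; [left|right].
  + replace z with (z + RtoC d - RtoC d)%C by ring. rewrite E1. ring.
  + destruct (Ceq_dec (chi d H s r (rho * (1 - k) * exp (- k)) z) 0) as [E2|E2]; auto.
    now destruct (Cmult_neq_0 _ _ E1 E2).
- intros [->| ->]; ring.
Qed.

(** [C_derive] is a limit of difference quotients taken along the horizontal
    line through the point, so at a real point of a function that is real on
    the real axis it is the ordinary derivative. *)
Lemma C_derive_RtoC (f : C -> C) (g : R -> R) (x l : R) :
  (forall t, f (RtoC t) = RtoC (g t)) -> is_derive g x l ->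
  C_derive f (RtoC x) = RtoC l.
Proof.
intros Hfg Hg.
assert (Hlim : is_lim (fun t => (g t - g x) / (t - x)) x l).
{ apply is_lim_spec. intros eps. apply is_derive_Reals in Hg.
  destruct (Hg eps (cond_pos eps)) as [del Hdel].
  exists del. intros t Ht Hne. specialize (Hdel (t - x)).
  rewrite Rplus_minus in Hdel. apply Hdel; [lra|exact Ht]. }
assert (Q : forall t, t <> x ->
  ((f (RtoC t) - f (RtoC x)) / (RtoC t - RtoC x))%C = RtoC ((g t - g x) / (t - x))).
{ intros t Ht. rewrite !Hfg, RtoC_div, !RtoC_minus by lra. reflexivity. }
unfold C_derive, C_lim.
change (snd (RtoC x)) with 0; change (fst (RtoC x)) with x.
apply (f_equal2 pair).
- transitivity (real (Finite l)); [|reflexivity]. apply (f_equal real), is_lim_unique.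
  apply is_lim_ext_loc with (fun t => (g t - g x) / (t - x)); auto.
  exists (mkposreal 1 Rlt_0_1). intros t _ Ht.
  change (t, 0) with (RtoC t). now rewrite Q.
- transitivity (real (Finite 0)); [|reflexivity]. apply (f_equal real), is_lim_unique.
  apply is_lim_ext_loc with (fun _ => 0); [|apply is_lim_const].
  exists (mkposreal 1 Rlt_0_1). intros t _ Ht.
  change (t, 0) with (RtoC t). now rewrite Q.
Qed.

(** On the real axis the characteristic function is (t + d) chi(t); at a zero
    of chi its derivative is (x + d) chi'(x) > 0. *)
Lemma char_fun_simple_zero (d rho H r s x : R) :
  short_delay d H s -> 0 <= r -> 0 <= rho -> 0 <= x ->
  chi_real d H s r rho x = 0 ->
  has_order (char_fun (rhs d rho H) r s (0, 0)) (RtoC x) 1.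
Proof.
intros Hsd Hr Hrho Hx E.
assert (Hreal : forall t, char_fun (rhs d rho H) r s (0, 0) (RtoC t)
   = RtoC ((t + d) * chi_real d H s r rho t)).
{ intros t. rewrite char_fun_rhs, Rminus_0_r, Ropp_0, exp_0, !Rmult_1_r, chi_RtoC.
  now rewrite <- RtoC_plus, <- RtoC_mult. }
split.
- intros k Hk. replace k with 0%nat by lia. simpl.
  now rewrite Hreal, E, Rmult_0_r.
- destruct (chi_real_derive d H s r rho x) as [l [Hl0 Hl]]; auto.
  simpl. rewrite (C_derive_RtoC _ _ x ((x + d) * l) Hreal).
  + intros F. apply RtoC_inj in F. destruct Hsd as [Hd _]. nra.
  + assert (H1 : is_derive (fun t => t + d) x 1) by (auto_derive; auto).
    pose proof (is_derive_mult _ _ x _ _ H1 Hl Rmult_comm) as Hm.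
    replace ((x + d) * l) with (plus (mult 1 (chi_real d H s r rho x)) (mult (x + d) l)).
    * exact Hm.
    * unfold plus, mult; simpl. rewrite E. ring.
Qed.

(** * Stability of the two equilibria *)

Theorem lemma4 (delta rho H sigma0 sigma r : R)
  (Hdelta : 0 < delta) (Hrho : 0 < rho) (HH : 0 < H)
  (Hratio : 1 < rho / (delta + H) <= exp 1)
  (Hsigma0_pos : 0 < sigma0)
  (Hsigma0 : H * sigma0 * exp (1 + delta * sigma0) = 1)
  (Hsigma : 0 <= sigma <= sigma0)
  (Hr : 0 <= r < r_star delta rho H) :
  let F := rhs delta rho H in
  let E1 : vec := (0, 0) in
  let E2 : vec := (kappa delta rho H, kappa delta rho H) in
  is_equilibrium F E1 /\
  is_equilibrium F E2 /\
  (forall z : C, is_char_root F r sigma E2 z -> Re z < 0) /\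
  hyperbolic F r sigma E1 /\
  unstable_dim F r sigma E1 1.
Proof.
intros F E1 E2.
assert (Hdr : delta + H < rho).
{ destruct Hratio as [Hlt _]. apply Rmult_lt_compat_r with (r := delta + H) in Hlt; [|lra].
  unfold Rdiv in Hlt. rewrite Rmult_assoc, Rinv_l in Hlt; lra. }
assert (Hsd : short_delay delta H sigma).
{ repeat split; try lra.
  apply Rle_trans with (H * sigma0 * exp (1 + delta * sigma0)); [|lra].
  assert (exp (1 + delta * sigma) <= exp (1 + delta * sigma0))
    by (apply exp_le_exp; nra).
  pose proof (exp_pos (1 + delta * sigma)).
  apply Rmult_le_compat; [apply Rmult_le_pos|left|apply Rmult_le_compat_l|]; lra. }
(* kappa is chosen so that rho e^(-kappa) = delta + H; this gives both the
   equilibrium equation and the coefficient (delta + H) (1 - kappa) at E2 *)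
assert (Hq : rho * exp (- kappa delta rho H) = delta + H).
{ unfold kappa. rewrite exp_Ropp, exp_ln by lra. field; lra. }
assert (Hk : 0 < kappa delta rho H <= 1).
{ unfold kappa. split.
  - rewrite <- ln_1. apply ln_increasing; lra.
  - rewrite <- (ln_exp 1). apply ln_le; lra. }
(* at E1 every root outside the open left half-plane is real; the factor
   z + delta contributes only the negative root - delta *)
assert (Hroot1 : forall z, is_char_root F r sigma E1 z -> 0 <= Re z ->
  exists x, z = RtoC x /\ chi_real delta H sigma r rho x = 0).
{ intros z Hz Hre. apply char_root_rhs in Hz as [->|Hz].
  - simpl in Hre. lra.
  - rewrite Rminus_0_r, Ropp_0, exp_0, !Rmult_1_r in Hz.
    destruct z as [x y]. simpl in Hre.
    assert (y = 0) by now apply (chi_no_nonreal_zero delta H sigma r rho x y).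
    subst y. exists x. split; auto. change (x, 0) with (RtoC x) in Hz.
    rewrite chi_RtoC in Hz. now apply RtoC_inj. }
assert (Hchi0 : chi_real delta H sigma r rho 0 < 0).
{ unfold chi_real. rewrite !Rmult_0_r, Ropp_0, exp_0. lra. }
split; [|split; [|split; [|split]]].
- unfold is_equilibrium, F, E1, rhs. simpl. f_equal; ring.
- unfold is_equilibrium, F, E2, rhs. simpl.
  rewrite (Rmult_assoc rho), (Rmult_comm (kappa _ _ _) (exp _)), <- Rmult_assoc, Hq.
  f_equal; ring.
- intros z Hz. apply char_root_rhs in Hz as [->|Hz]; [simpl; lra|].
  apply dominated_chi_stable in Hz; auto; try lra.
  replace (rho * (1 - kappa delta rho H) * exp (- kappa delta rho H))
    with ((delta + H) * (1 - kappa delta rho H)) by (rewrite <- Hq; ring).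
  nra.
- intros z Hz Hre. destruct (Hroot1 z Hz) as [x [-> Hx]]; [lra|].
  simpl in Hre. subst x. lra.
- destruct (chi_real_positive_zero delta H sigma r rho) as [x0 [Hx0 Ex0]]; try lra.
  exists ((RtoC x0, 1%nat) :: nil). simpl. split; [|split; [|split]].
  + repeat constructor. intros [].
  + intros z. split.
    * intros [<-|[]]. split; [|exact Hx0]. apply char_root_rhs. right.
      rewrite Rminus_0_r, Ropp_0, exp_0, !Rmult_1_r, chi_RtoC. now rewrite Ex0.
    * intros [Hz Hre]. left. destruct (Hroot1 z Hz) as [x [-> Hx]]; [lra|].
      simpl in Hre. f_equal.
      destruct (Rtotal_order x0 x) as [Hlt|[Heq|Hlt]]; auto; exfalso.
      -- pose proof (chi_real_increasing delta H sigma r rho x0 x Hsd); lra.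
      -- pose proof (chi_real_increasing delta H sigma r rho x x0 Hsd); lra.
  + intros z m [Em|[]]. injection Em as <- <-.
    apply char_fun_simple_zero; auto; lra.
  + reflexivity.
Qed.
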